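(* Let $P(\lambda)=I\lambda^2+U_1\lambda+U_0$ be an $n\times n$ quaternion matrix polynomial, where $U_0,U_1\in M_n(\mathbb{H})$ are commuting unitary matrices. Then the block companion matrix $$C_P=\begin{bmatrix}0&I\\-U_0&-U_1\end{bmatrix}\in M_{2n}(\mathbb{H})$$ of $P(\lambda)$ is diagonalizable.
   Context: $\mathbb{H}$ is the set of real quaternions and $M_N(\mathbb{H})$ is the set of $N\times N$ matrices over $\mathbb{H}$. A matrix $A$ over $\mathbb{H}$ is unitary if $AA^*=I=A^*A$, where $A^*$ is the conjugate transpose. A quaternion $\lambda_0$ is a right eigenvalue of $A\in M_N(\mathbb{H})$ if $Ax=x\lambda_0$ for some nonzero $x\in\mathbb{H}^N$. Every $A\in M_N(\mathbb{H})$ has exactly $N$ (counted with multiplicity) right eigenvalues that are complex numbers with nonnegative imaginary part; these are called the standard eigenvalues of $A$. Multiplicities are as follows: write $A=A_1+A_2 j$ with $A_1,A_2\in M_N(\mathbb{C})$ and let $\chi_A=\begin{bmatrix}A_1&A_2\\-\overline{A_2}&\overline{A_1}\end{bmatrix}\in M_{2N}(\mathbb{C})$; then $\lambda_1,\dots,\lambda_N$ (with nonnegative imaginary parts) are the standard eigenvalues of $A$ exactly when the eigenvalues of $\chi_A$, counted with algebraic multiplicity, are $\lambda_1,\dots,\lambda_N,\bar\lambda_1,\dots,\bar\lambda_N$. $A\in M_N(\mathbb{H})$ is diagonalizable if there is an invertible $S\in M_N(\mathbb{H})$ with $S^{-1}AS=\operatorname{diag}(\lambda_1,\dots,\lambda_N)$,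 where the $\lambda_i$ are the standard eigenvalues of $A$. *)

(* Defs.v *)
From HB Require Import structures.
From mathcomp Require Import all_boot all_order all_algebra.
From mathcomp Require Import complex.
From mathcomp Require Import ring.
From mathcomp Require Import reals.

Set Implicit Arguments.
Unset Strict Implicit.
Unset Printing Implicit Defensive.

Import Order.TTheory GRing.Theory Num.Theory.

Local Open Scope ring_scope.

(* [Quat a b] is the quaternion a + b j with a, b complex (i.e. H = C + C j),
   where j^2 = -1 and j z = conj(z) j for z complex. *)
Record quat (R : Type) : Type := Quat { qfst : R[i]; qsnd : R[i] }.

Section QuaternionRing.
Variable R : realType.
Implicit Types p q r : quat R.

Definition pair_of_quat q : R[i] * R[i] := (qfst q, qsnd q).
Definition quat_of_pair (z : R[i] * R[i]) : quat R := Quat z.1 z.2.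

Lemma pair_of_quatK : cancel pair_of_quat quat_of_pair.
Proof. by case. Qed.

HB.instance Definition _ := Equality.copy (quat R) (can_type pair_of_quatK).
HB.instance Definition _ := Choice.copy (quat R) (can_type pair_of_quatK).

Definition addq p q := Quat (qfst p + qfst q) (qsnd p + qsnd q).
Definition oppq q := Quat (- qfst q) (- qsnd q).
Definition zeroq : quat R := Quat 0 0.
Definition oneq : quat R := Quat 1 0.

(* (a + b j)(c + d j) = (a c - b conj(d)) + (a d + b conj(c)) j *)
Definition mulq p q :=
  Quat (qfst p * qfst q - qsnd p * conjc (qsnd q))
       (qfst p * qsnd q + qsnd p * conjc (qfst q)).

Lemma addqA : associative addq.
Proof. by move=> [a b] [c d] [e f]; rewrite /addq /= !addrA. Qed.
Lemma addqC : commutative addq.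
Proof. by move=> [a b] [c d]; rewrite /addq /= addrC [b + d]addrC. Qed.
Lemma add0q : left_id zeroq addq.
Proof. by move=> [a b]; rewrite /addq /= !add0r. Qed.
Lemma addNq : left_inverse zeroq oppq addq.
Proof. by move=> [a b]; rewrite /addq /= !addNr. Qed.

HB.instance Definition _ :=
  GRing.isZmodule.Build (quat R) addqA addqC add0q addNq.

Lemma mulqA : associative mulq.
Proof.
move=> [a b] [c d] [e f]; rewrite /mulq /=.
rewrite !(rmorphD, rmorphN, rmorphM) /= !conjcK.
by congr Quat; ring.
Qed.
Lemma mul1q : left_id oneq mulq.
Proof. by move=> [a b]; rewrite /mulq /= !mul1r !mul0r subr0 addr0. Qed.
Lemma mulq1 : right_id oneq mulq.
Proof.
move=> [a b]; rewrite /mulq /oneq; cbn [qfst qsnd].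
by rewrite rmorph0 rmorph1 !mulr1 !mulr0 subr0 add0r.
Qed.
Lemma mulqDl : left_distributive mulq addq.
Proof.
move=> [a b] [c d] [e f]; rewrite /mulq /addq /=.
by congr Quat; ring.
Qed.
Lemma mulqDr : right_distributive mulq addq.
Proof.
move=> [a b] [c d] [e f]; rewrite /mulq /addq /=.
by rewrite !rmorphD /=; congr Quat; ring.
Qed.
Lemma oneq_neq0 : oneq != 0.
Proof. by apply/eqP => -[/eqP]; rewrite oner_eq0. Qed.

HB.instance Definition _ :=
  GRing.Zmodule_isNzRing.Build (quat R)
    mulqA mul1q mulq1 mulqDl mulqDr oneq_neq0.

Definition quat_of_complex (z : R[i]) : quat R := Quat z 0.

(* conj(a + b j) = conj(a) - b j *)
Definition conjq q : quat R := Quat (conjc (qfst q)) (- qsnd q).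

Definition quat_i : quat R := Quat (Complex 0 1) 0.
Definition quat_j : quat R := Quat 0 1.
Definition quat_k : quat R := Quat 0 (Complex 0 1).

Lemma quat_hamilton :
  [/\ quat_i * quat_i = -1, quat_j * quat_j = -1, quat_k * quat_k = -1
    & quat_i * quat_j * quat_k = -1].
Proof.
by split; congr Quat; apply/eqP; rewrite eq_complex /= ?(mul0r, mulr0, mul1r,
  mulr1, oppr0, addr0, add0r, subr0, opprK) !eqxx.
Qed.

End QuaternionRing.

Section QuaternionMatrices.
Variable R : realType.

Definition conjtrmxq (m n : nat) (A : 'M[quat R]_(m, n)) : 'M[quat R]_(n, m) :=
  map_mx (@conjq R) A^T.

Definition unitarymxq (n : nat) (A : 'M[quat R]_n) : Prop :=
  A *m conjtrmxq A = 1%:M /\ conjtrmxq A *m A = 1%:M.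

(* In [x *m l%:M], [l%:M] is a 1 x 1 matrix: the scalar acts on the right. *)
Definition right_eigenvalue (N : nat) (A : 'M[quat R]_N) (l : quat R) : Prop :=
  exists2 x : 'cV[quat R]_N, x != 0 & A *m x = x *m l%:M.

(* For A = A1 + A2 j, the complex matrix [[A1, A2], [- conj(A2), conj(A1)]]. *)
Definition chi_mx (N : nat) (A : 'M[quat R]_N) : 'M[R[i]]_(N + N) :=
  let A1 := map_mx (@qfst R) A in
  let A2 := map_mx (@qsnd R) A in
  block_mx A1 A2 (- map_mx (@conjc R) A2) (map_mx (@conjc R) A1).

(* The entries of [l], listed with multiplicity, are the standard eigenvalues
   of [A]; the multiplicities are read off the algebraic multiplicities of the
   eigenvalues l_i, conj(l_i) of [chi_mx A]. *)
Definition standard_eigenvalues (N : nat) (A : 'M[quat R]_N) (l : 'rV[R[i]]_N)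
    : Prop :=
  [/\ forall i, right_eigenvalue A (quat_of_complex (l 0 i)),
      forall i, 0 <= complex.Im (l 0 i)
    & char_poly (chi_mx A) =
        \prod_i ('X - (l 0 i)%:P) * \prod_i ('X - (conjc (l 0 i))%:P)].

(* [unitmx] needs a commutative ring, hence the explicit two-sided inverse. *)
Definition diagonalizablemxq (N : nat) (A : 'M[quat R]_N) : Prop :=
  exists S Sinv : 'M[quat R]_N, exists l : 'rV[R[i]]_N,
    [/\ S *m Sinv = 1%:M, Sinv *m S = 1%:M, standard_eigenvalues A l
      & Sinv *m A *m S = diag_mx (map_mx (@quat_of_complex R) l)].

(* The block companion matrix of P(x) = I x^2 + U1 x + U0. *)
Definition block_companion (n : nat) (U0 U1 : 'M[quat R]_n)
    : 'M[quat R]_(n + n) :=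
  block_mx 0 1%:M (- U0) (- U1).

End QuaternionMatrices.

(* Main.v *)
(* The complex matrices attached to U0 and U1 are commuting unitaries, hence have
   a common eigenbasis; read as quaternion columns, its vectors v span H^n on the
   right and satisfy U0 v = v a, U1 v = v b with a, b complex of modulus 1. Since
   |b^2 - 4 a| >= 3, the polynomial t^2 + b t + a has two distinct roots r and s,
   and (v, v r), (v, v s) are right eigenvectors of the companion matrix whose
   right span contains (v, 0) and (0, v). So the eigenvectors span H^(2n), and
   Steinitz exchange extracts from them an invertible matrix of eigenvectors. *)
Require Import Defs.
From mathcomp Require Import all_boot all_order all_algebra.
From mathcomp Require Import complex ring reals.

Set Implicit Arguments.
Unset Strict Implicit.
Unset Printing Implicit Defensive.

Import Order.TTheory GRing.Theory Num.Theory.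
Local Open Scope ring_scope.
Local Open Scope sesquilinear_scope.

(** * Steinitz exchange over a noncommutative ring *)

(** The entry [(Ti *m x) j 0] is the [j]-th coordinate of [x] in the basis formed by the columns of
    [T]; since it is invertible, [x] can take the place of column [j]. Without determinants, both
    inverse identities must be carried along. *)
Lemma steinitz_replace (K : nzRingType) (N : nat) (T Ti : 'M[K]_N)
    (j : 'I_N) (x : 'cV[K]_N) (d : K) :
  T *m Ti = 1%:M -> Ti *m T = 1%:M ->
  (Ti *m x) j 0 * d = 1 -> d * (Ti *m x) j 0 = 1 ->
  exists T' Ti' : 'M[K]_N, [/\ T' *m Ti' = 1%:M, Ti' *m T' = 1%:M,
    col j T' = x & forall i, i != j -> col i T' = col i T].
Proof.
move=> TTi TiT cd dc.
pose e : 'rV[K]_N := delta_mx 0 j.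
pose u := Ti *m x - e^T.
(* So [1 + e u] is the coordinate inverted by [d], and [F] below is the Sherman-Morrison inverse of
   the rank-one update [E]. *)
have eu : e *m u = ((Ti *m x) j 0 - 1)%:M.
  rewrite mulmxBr -rowE; apply/matrixP => a b; rewrite !ord1 !mxE.
  rewrite eqxx mulr1n; congr (_ - _).
  rewrite (bigD1 j) //= !mxE !eqxx mulr1 big1 ?addr0 // => k /negPf kj.
  by rewrite !mxE kj andbF mul0r.
(* E is the identity with column j replaced by [Ti *m x], and F its inverse. *)
pose E := 1%:M + u *m e.
pose F := 1%:M - u *m d%:M *m e.
have EF : E *m F = 1%:M.
  rewrite mulmxBr mulmx1 mulmxDl mul1mx !mulmxA -(mulmxA u e u) eu.
  rewrite -addrA -[RHS]addr0; congr (_ + _).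
  rewrite -mulmxDl -mulmxBl -(mulmxA u) -mulmxDr -{1}(mulmx1 u) -mulmxBr.
  rewrite -scalar_mxM -!raddfD -raddfB /= mulrBl cd mul1r addrCA subrr addr0 subrr.
  by rewrite raddf0 mulmx0 mul0mx.
have FE : F *m E = 1%:M.
  rewrite mulmxDr mulmx1 mulmxBl mul1mx !mulmxA -(mulmxA (u *m d%:M) e u) eu.
  rewrite -addrA -[RHS]addr0; congr (_ + _).
  rewrite -mulmxBl -mulNmx -mulmxDl -(mulmxA u) -scalar_mxM -mulmxN addrCA.
  rewrite -mulmxN -mulmxDr -[X in X + _]mulmx1 -mulmxDr -!raddfN -!raddfD /=.
  rewrite mulrBr dc mulr1 addrCA subrr addr0 subrr.
  by rewrite raddf0 mulmx0 mul0mx.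
exists (T *m E), (F *m Ti); split.
- by rewrite -mulmxA (mulmxA E) EF mul1mx.
- by rewrite -mulmxA (mulmxA Ti) TiT mul1mx.
- rewrite mulmxDr mulmx1 mulmxA mulmxBr mulmxA TTi mul1mx.
  rewrite trmx_delta -colE; apply/colP => i; rewrite !mxE big_ord1 !mxE.
  by rewrite !eqxx mulr1 addrC subrK.
- move=> i /negPf ij; rewrite mulmxDr mulmx1 mulmxA; apply/colP => k.
  by rewrite !mxE big_ord1 !mxE ij andbF mulr0 addr0.
Qed.

(** [sepP] is the dual form of spanning: no nonzero row kills every vector in [P]. Starting from the
    identity, columns are exchanged one by one; [sepP] applied to row [j] of the current inverse
    yields a vector with nonzero [j]-th coordinate. *)
Lemma invertible_with_cols (K : nzRingType)
    (inv : forall c : K, c != 0 -> exists d, c * d = 1 /\ d * c = 1)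
    (N : nat) (P : 'cV[K]_N -> Prop)
    (sepP : forall w : 'rV[K]_N, w != 0 -> exists2 x, P x & w *m x != 0) :
  exists T Ti : 'M[K]_N,
    [/\ T *m Ti = 1%:M, Ti *m T = 1%:M & forall i, P (col i T)].
Proof.
suff: forall k, (k <= N)%N -> exists T Ti : 'M[K]_N,
    [/\ T *m Ti = 1%:M, Ti *m T = 1%:M
      & forall i : 'I_N, (i < k)%N -> P (col i T)].
  by move=> /(_ N (leqnn N)) [T [Ti [? ? PT]]]; exists T, Ti; split => // i; apply: PT.
elim=> [_|k IH kN]; first by exists 1%:M, 1%:M; rewrite mulmx1.
have [T [Ti [TTi TiT PT]]] := IH (ltnW kN).
pose j := Ordinal kN.
have wn0 : row j Ti != 0.
  apply/eqP => w0; have : row j (Ti *m T) = 0 by rewrite row_mul w0 mul0mx.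
  by rewrite TiT => /rowP/(_ j)/eqP; rewrite !mxE eqxx oner_eq0.
have [x Px wx] := sepP _ wn0.
have cn0 : (Ti *m x) j 0 != 0.
  apply: contra wx => /eqP c0; apply/eqP/matrixP => a b.
  by rewrite !ord1 -row_mul !mxE -[RHS]c0 mxE.
have [d [cd dc]] := inv _ cn0.
have [T' [Ti' [TTi' TiT' xj oth]]] := steinitz_replace TTi TiT cd dc.
exists T', Ti'; split => // i.
rewrite ltnS leq_eqVlt => /orP[/eqP ik|ik].
  by rewrite (_ : i = j) ?xj //; apply: val_inj.
have ij : i != j by rewrite -val_eqE ltn_eqF.
by rewrite oth //; apply: PT.
Qed.

(** * Linear algebra over commutative rings *)

Lemma unitarymx_codiag (C : numClosedFieldType) (n : nat) (A B : 'M[C]_n) :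
  A \is unitarymx -> B \is unitarymx -> A *m B = B *m A ->
  exists P : 'M[C]_n, exists a b : 'rV[C]_n,
    [/\ P \in unitmx, A *m P = P *m diag_mx a, B *m P = P *m diag_mx b,
        forall i, `|a 0 i| = 1 & forall i, `|b 0 i| = 1].
Proof.
move=> uA uB AB.
have uK (X : 'M[C]_n) : X \is unitarymx -> X ^t* *m X = 1%:M.
  by move=> /unitarymxP; apply: mulmx1C.
(* Multiplying [X Y = Y X] by the adjoint of [X] on both sides shows that this adjoint commutes with
   [Y] too. *)
have cinv (X Y : 'M[C]_n) :
    X \is unitarymx -> X *m Y = Y *m X -> X ^t* *m Y = Y *m X ^t*.
  move=> uX XY; rewrite -[Y in LHS]mulmx1 -(unitarymxP uX) (mulmxA Y) -XY.
  by rewrite !mulmxA uK // mul1mx.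
have cAA := cinv A A uA erefl; have cBB := cinv B B uB erefl.
have cAB := cinv A B uA AB; have cBA := cinv B A uB (esym AB).
have cABt : A ^t* *m B ^t* = B ^t* *m A ^t* by apply: cinv.
(* Including the adjoints makes the triangular forms of A and B diagonal. *)
have [|Q uQ /allP /= tQ] := @cotrigonalization C n [:: A; B; A ^t*; B ^t*].
  move=> X Y; rewrite !inE /comm_mx.
  by move=> /or4P[] /eqP-> /or4P[] /eqP->; first [done | apply: esym; done].
have trigQ X : X \in [:: A; B; A ^t*; B ^t*] -> is_trig_mx (conjmx Q X).
  exact: tQ.
have diagX (X : 'M[C]_n) : X \is unitarymx ->
    is_trig_mx (conjmx Q X) -> is_trig_mx (conjmx Q (X^t*)) ->
    exists2 x : 'rV[C]_n,
      X *m Q^t* = Q^t* *m diag_mx x & forall i, `|x 0 i| = 1.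
  move=> uX t1 t2.
  pose D := conjmx Q X.
  have Dt : conjmx Q (X^t*) = D^t*.
    by rewrite /D !conjymx // !trmx_mul !map_mxM trmxCK mulmxA.
  have uD : D \is unitarymx.
    by rewrite /D conjymx //; rewrite !mul_unitarymx ?trmxC_unitary.
  (* Entries above the diagonal vanish because [D] is lower triangular, those below because its
     adjoint is. *)
  have /diag_mxP [x Dx] : is_diag_mx D.
    apply/is_diag_mxP => i j; case: ltngtP => // [ij|ji] _.
      by move/is_trig_mxP: t1; apply.
    move: t2; rewrite Dt => /is_trig_mxP /(_ j i ji)/eqP.
    by rewrite !mxE conjC_eq0 => /eqP.
  exists x.
    by rewrite -Dx /D conjymx // !mulmxA uK // mul1mx.
  move=> i; have /unitarymxP/matrixP/(_ i i) := uD.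
  rewrite Dx tr_diag_mx map_diag_mx mulmx_diag !mxE eqxx !mulr1n -normCK => /eqP.
  by rewrite sqrp_eq1 ?normr_ge0 // => /eqP.
have [a Aa a1] : exists2 a : 'rV[C]_n,
    A *m Q^t* = Q^t* *m diag_mx a & forall i, `|a 0 i| = 1.
  by apply: diagX => //; apply: trigQ; rewrite !inE eqxx ?orbT.
have [b Bb b1] : exists2 b : 'rV[C]_n,
    B *m Q^t* = Q^t* *m diag_mx b & forall i, `|b 0 i| = 1.
  by apply: diagX => //; apply: trigQ; rewrite !inE eqxx ?orbT.
exists (Q^t*), a, b; split => //.
by apply/unitarymx_unit; rewrite trmxC_unitary.
Qed.

Lemma distinct_roots (C : numClosedFieldType) (a b : C) :
  `|a| = 1 -> `|b| = 1 ->
  exists r s, [/\ r != s, r ^+ 2 + b * r + a = 0 & s ^+ 2 + b * s + a = 0].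
Proof.
move=> a1 b1; pose D := b ^+ 2 - 4 * a.
(* If [b ^+ 2 = 4 * a], taking moduli gives [1 = 4]. *)
have Dn0 : D != 0.
  apply/eqP => /eqP; rewrite subr_eq0 => /eqP /(congr1 Num.norm).
  rewrite normrX normrM a1 b1 expr1n mulr1 normr_nat => /eqP.
  by rewrite -[1]/(1%:R) eqr_nat.
have sD : sqrtC D ^+ 2 = D by rewrite sqrtCK.
exists ((- b + sqrtC D) / 2), ((- b - sqrtC D) / 2); split.
- rewrite -subr_eq0.
  suff -> : (- b + sqrtC D) / 2 - (- b - sqrtC D) / 2 = sqrtC D.
    by rewrite sqrtC_eq0.
  by field.
- transitivity ((sqrtC D ^+ 2 - D) / 4); last by rewrite sD subrr mul0r.
  by rewrite /D; field.
- transitivity ((sqrtC D ^+ 2 - D) / 4); last by rewrite sD subrr mul0r.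
  by rewrite /D; field.
Qed.

Lemma char_poly_similar (K : comNzRingType) n (P Pi D : 'M[K]_n) :
  P *m Pi = 1%:M -> char_poly (P *m D *m Pi) = char_poly D.
Proof.
move=> PPi; pose f := @map_mx _ _ (@polyC K) n n.
have ff : f P *m f Pi = 1%:M by rewrite -map_mxM PPi map_mx1.
have fdet : \det (f P) * \det (f Pi) = 1 by rewrite -det_mulmx ff det1.
suff -> : char_poly (P *m D *m Pi) = \det (f P *m char_poly_mx D *m f Pi).
  by rewrite !det_mulmx mulrAC fdet mul1r.
congr (\det _); rewrite /char_poly_mx mulmxBr mulmxBl -!map_mxM; congr (_ - _).
by rewrite scalar_mxC -mulmxA ff mulmx1.
Qed.

(** * The complex representation of quaternion matrices *)

Section Quaternions.
Variable R : realType.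
Local Notation C := R[i].
Local Notation Hq := (@quat_of_complex R).

Lemma qfst_sum (I : Type) (r : seq I) (F : I -> quat R) :
  qfst (\sum_(i <- r) F i) = \sum_(i <- r) qfst (F i).
Proof. exact: (big_morph (@qfst R) (fun _ _ => erefl) erefl). Qed.

Lemma qsnd_sum (I : Type) (r : seq I) (F : I -> quat R) :
  qsnd (\sum_(i <- r) F i) = \sum_(i <- r) qsnd (F i).
Proof. exact: (big_morph (@qsnd R) (fun _ _ => erefl) erefl). Qed.

Lemma quat_of_complexM (a b : C) : Hq (a * b) = Hq a * Hq b.
Proof. by congr Quat; rewrite /= ?rmorph0 ?(mulr0, mul0r, subr0, addr0). Qed.

Lemma quat_of_complexN (a : C) : Hq (- a) = - Hq a.
Proof. by congr Quat; rewrite /= oppr0. Qed.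

Lemma quat_of_complexD (a b : C) : Hq (a + b) = Hq a + Hq b.
Proof. by congr Quat; rewrite /= addr0. Qed.

Lemma quat_inv (q : quat R) : q != 0 -> exists p, q * p = 1 /\ p * q = 1.
Proof.
case: q => a b qn0.
(* [N] is the squared modulus of [q], fixed by conjugation; the inverse is the conjugate of [q]
   divided by [N]. *)
pose N := a * conjc a + b * conjc b.
have Nn0 : N != 0.
  apply: contra qn0; rewrite /N -!normCK paddr_eq0 ?sqr_ge0 ?exprn_ge0 //.
  by rewrite !expf_eq0 /= !normr_eq0 => /andP[/eqP-> /eqP->].
have Nr : conjc N = N.
  by rewrite /N rmorphD !rmorphM /= !conjcK; ring.
have Nir : conjc N^-1 = N^-1 by rewrite fmorphV /= Nr.
exists (Quat (conjc a / N) (- (b / N))); split; congr Quat;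
  rewrite /= ?(rmorphM, rmorphN) /= ?conjcK ?Nir.
- by rewrite -[RHS](mulfV Nn0) /N; ring.
- by ring.
- by rewrite -[RHS](mulfV Nn0) /N; ring.
- by ring.
Qed.

(* The rectangular version of [chi_mx]. *)
Definition chi m n (A : 'M[quat R]_(m, n)) : 'M[C]_(m + m, n + n) :=
  let A1 := map_mx (@qfst R) A in
  let A2 := map_mx (@qsnd R) A in
  block_mx A1 A2 (- map_mx (@conjc R) A2) (map_mx (@conjc R) A1).

Lemma chi_mxE n (A : 'M[quat R]_n) : chi_mx A = chi A.
Proof. by []. Qed.

Lemma mulmx_qfst m n p (A : 'M[quat R]_(m, n)) (B : 'M_(n, p)) :
  map_mx (@qfst R) (A *m B) = map_mx (@qfst R) A *m map_mx (@qfst R) B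
    - map_mx (@qsnd R) A *m map_mx (@conjc R) (map_mx (@qsnd R) B).
Proof.
apply/matrixP => i j; rewrite !mxE qfst_sum -sumrB.
by apply: eq_bigr => k _; rewrite !mxE.
Qed.

Lemma mulmx_qsnd m n p (A : 'M[quat R]_(m, n)) (B : 'M_(n, p)) :
  map_mx (@qsnd R) (A *m B) = map_mx (@qfst R) A *m map_mx (@qsnd R) B
    + map_mx (@qsnd R) A *m map_mx (@conjc R) (map_mx (@qfst R) B).
Proof.
apply/matrixP => i j; rewrite !mxE qsnd_sum -big_split.
by apply: eq_bigr => k _; rewrite !mxE.
Qed.

Lemma map_conjcK m n (A : 'M[C]_(m, n)) :
  map_mx (@conjc R) (map_mx (@conjc R) A) = A.
Proof. by apply/matrixP => i j; rewrite !mxE conjcK. Qed.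

(** The rule [j z = conj(z) j] makes the upper blocks agree; the lower blocks are their conjugates
    up to sign. *)
Lemma chiM m n p (A : 'M[quat R]_(m, n)) (B : 'M_(n, p)) :
  chi (A *m B) = chi A *m chi B.
Proof.
rewrite /chi mulmx_block mulmx_qfst mulmx_qsnd.
rewrite !(map_mxD, map_mxN, map_mxM) /= !map_conjcK.
rewrite !mulmxN !mulNmx opprD; congr block_mx;
  by rewrite addrC.
Qed.

Lemma chi1 n : chi (1%:M : 'M[quat R]_n) = 1%:M.
Proof.
rewrite /chi [RHS]scalar_mx_block; congr block_mx; apply/matrixP => i j;
  rewrite !mxE; case: (i == j); rewrite /= ?(rmorph0, rmorph1, oppr0) //.
Qed.

Lemma chi_conjtrmxq n (A : 'M[quat R]_n) : chi (conjtrmxq A) = (chi A) ^t*.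
Proof.
rewrite /chi tr_block_mx map_block_mx; congr block_mx; apply/matrixP => i j;
  rewrite !mxE /= ?rmorphN /= ?opprK //.
- by congr (- _); rewrite -[LHS]conjcK.
Qed.

Lemma chi_unitary n (A : 'M[quat R]_n) : unitarymxq A -> chi A \is unitarymx.
Proof. by case=> AA _; apply/unitarymxP; rewrite -chi_conjtrmxq -chiM AA chi1. Qed.

Lemma chi_eq0 m n (A : 'M[quat R]_(m, n)) : chi A = 0 -> A = 0.
Proof.
rewrite /chi -[0]block_mx0 => /eq_block_mx[A1 A2 _ _].
apply/matrixP => i j; rewrite mxE; case E : (A i j) => [a b].
move/matrixP/(_ i j): A1; move/matrixP/(_ i j): A2.
by rewrite !mxE E /= => -> ->.
Qed.

(* The columns of [qmx Y] are the quaternion columns whose [chi] has the columns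
   of [Y] as its first column; this turns eigenvectors of [chi A] into right
   eigenvectors of [A] with a complex eigenvalue. *)
Definition qmx n p (Y : 'M[C]_(n + n, p)) : 'M[quat R]_(n, p) :=
  \matrix_(i, j) Quat (usubmx Y i j) (- conjc (dsubmx Y i j)).

Lemma qmx_inj n p : injective (@qmx n p).
Proof.
move=> X Y /matrixP XY; rewrite -[X]vsubmxK -[Y]vsubmxK.
congr col_mx; apply/matrixP => i j; have := XY i j; rewrite !mxE => -[E1 E2] //.
exact/(can_inj (@conjcK R))/oppr_inj.
Qed.

Lemma qmx_qfst n p (Y : 'M[C]_(n + n, p)) : map_mx (@qfst R) (qmx Y) = usubmx Y.
Proof. by apply/matrixP => i j; rewrite !mxE. Qed.

Lemma qmx_qsnd n p (Y : 'M[C]_(n + n, p)) :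
  map_mx (@qsnd R) (qmx Y) = - map_mx (@conjc R) (dsubmx Y).
Proof. by apply/matrixP => i j; rewrite !mxE. Qed.

Lemma quat_mxP m n (A B : 'M[quat R]_(m, n)) :
  map_mx (@qfst R) A = map_mx (@qfst R) B ->
  map_mx (@qsnd R) A = map_mx (@qsnd R) B -> A = B.
Proof.
move=> /matrixP AB1 /matrixP AB2; apply/matrixP => i j.
have := AB1 i j; have := AB2 i j; rewrite !mxE.
by case: (A i j) (B i j) => [a b] [c d] /= -> ->.
Qed.

(** [Y] is the first block column of [chi (qmx Y)], so this is the first block column of [chiM]. *)
Lemma mulmx_qmx m n p (A : 'M[quat R]_(m, n)) (Y : 'M[C]_(n + n, p)) :
  A *m qmx Y = qmx (chi A *m Y).
Proof.
have -> : chi A *m Y = col_mx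
    (map_mx (@qfst R) A *m usubmx Y + map_mx (@qsnd R) A *m dsubmx Y)
    (- map_mx (@conjc R) (map_mx (@qsnd R) A) *m usubmx Y
      + map_mx (@conjc R) (map_mx (@qfst R) A) *m dsubmx Y).
  by rewrite -{1}[Y]vsubmxK mul_block_col.
apply: quat_mxP.
- rewrite mulmx_qfst !qmx_qfst qmx_qsnd col_mxKu map_mxN map_conjcK.
  by rewrite mulmxN opprK.
- rewrite mulmx_qsnd !qmx_qsnd qmx_qfst col_mxKd map_mxD !map_mxM map_mxN /=.
  by rewrite !map_conjcK mulmxN mulNmx opprD opprK addrC.
Qed.

(** The conjugation in [qmx] makes it linear for complex scalars on the right:
    [conj(y) j d = conj(y d) j]. *)
Lemma qmx_mulmx n p q (Y : 'M[C]_(n + n, p)) (D : 'M[C]_(p, q)) :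
  qmx (Y *m D) = qmx Y *m map_mx Hq D.
Proof.
have D1 : map_mx (@qfst R) (map_mx Hq D) = D.
  by apply/matrixP => i j; rewrite !mxE.
have D2 : map_mx (@qsnd R) (map_mx Hq D) = 0.
  by apply/matrixP => i j; rewrite !mxE.
apply: quat_mxP.
- by rewrite mulmx_qfst !qmx_qfst D1 D2 map_mx0 mulmx0 subr0 mul_usub_mx.
- rewrite mulmx_qsnd !qmx_qsnd qmx_qfst D1 D2 mulmx0 add0r.
  by rewrite -mul_dsub_mx map_mxM mulNmx.
Qed.

(** [qmx Q] is [n] by [2n], so the fact that its columns span on the right is expressed by a trivial
    left kernel. *)
Lemma qmx_unit_lker m n (w : 'M[quat R]_(m, n)) (Q : 'M[C]_(n + n)) :
  Q \in unitmx -> w *m qmx Q = 0 -> w = 0.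
Proof.
move=> Qu; rewrite mulmx_qmx => w0; apply: chi_eq0.
rewrite -[chi w](mulmxK Qu) (_ : chi w *m Q = 0) ?mul0mx //.
apply: qmx_inj; rewrite w0; apply/matrixP => i j.
by rewrite !mxE rmorph0 oppr0.
Qed.


(* The pair [x] and [x j] has conjugate eigenvalues, so one of them lies in the
   closed upper half plane. *)
Lemma eigencol_upper n (A : 'M[quat R]_n) (w : 'rV[quat R]_n)
    (x : 'cV[quat R]_n) (l : C) :
  A *m x = x *m (Hq l)%:M -> w *m x != 0 ->
  exists2 y : 'cV[quat R]_n,
    (exists m, 0 <= complex.Im m /\ A *m y = y *m (Hq m)%:M) & w *m y != 0.
Proof.
move=> Ax wx; have [l0|l0] := leP 0 (complex.Im l); first by exists x => //; exists l.
pose j : quat R := quat_j R.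
have [_ jj _ _] := quat_hamilton R.
exists (x *m j%:M).
  exists (conjc l); split; first by case: l l0 {Ax} => a b /= /ltW; rewrite oppr_ge0.
  (* What remains is [l j = j conj(l)]. *)
  rewrite mulmxA Ax -!mulmxA -!scalar_mxM; congr (_ *m _%:M).
  by congr Quat; cbn [qfst qsnd j quat_j quat_of_complex];
    rewrite ?conjc0 ?conjc1 ?conjcK; ring.
apply: contra wx => /eqP; rewrite mulmxA => wxj.
(* Since [j * - j = 1], right multiplication by [j] loses nothing. *)
by rewrite -[w *m x]mulmx1 -[1](opprK 1) -jj -mulrN scalar_mxM mulmxA wxj mul0mx.
Qed.

Lemma chi_diag_mx n (l : 'rV[C]_n) :
  chi (diag_mx (map_mx Hq l)) =
    block_mx (diag_mx l) 0 0 (diag_mx (map_mx (@conjc R) l)).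
Proof.
rewrite /chi; congr block_mx; apply/matrixP => i j; rewrite !mxE;
  by case: (i == j); rewrite /= ?mulr1n ?mulr0n /= ?rmorph0 ?oppr0.
Qed.

Lemma char_poly_chi_diag n (l : 'rV[C]_n) :
  char_poly (chi (diag_mx (map_mx Hq l))) =
    \prod_i ('X - (l 0 i)%:P) * \prod_i ('X - (conjc (l 0 i))%:P).
Proof.
rewrite chi_diag_mx /char_poly char_block_diag_mx det_ublock.
rewrite -!/(char_poly _) !char_poly_trig ?diag_mx_is_trig //.
by congr (_ * _); apply: eq_bigr => i _; rewrite !mxE eqxx mulr1n.
Qed.

(** The multiplicities come for free: [chi A] is similar to [chi] of the diagonal matrix, whose
    characteristic polynomial is the required product. *)
Lemma diagonalizable_of_eigencols N (A T Ti : 'M[quat R]_N) :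
  T *m Ti = 1%:M -> Ti *m T = 1%:M ->
  (forall i, exists m, 0 <= complex.Im m /\
     A *m col i T = col i T *m (Hq m)%:M) ->
  diagonalizablemxq A.
Proof.
move=> TTi TiT /fin_all_exists[l0 /all_and2[l0ge0 eigT]].
pose l : 'rV[C]_N := \row_i l0 i.
have AT : A *m T = T *m diag_mx (map_mx Hq l).
  apply/matrixP => i k; transitivity (col k (A *m T) i 0); first by rewrite [RHS]mxE.
  rewrite colE -mulmxA -colE eigT !mxE big_ord1 (bigD1 k) //=.
  rewrite !mxE !eqxx !mulr1n big1 ?addr0 //.
  by move=> a /negPf ak; rewrite !mxE ak mulr0n mulr0.
have TAT : Ti *m A *m T = diag_mx (map_mx Hq l).
  by rewrite -mulmxA AT mulmxA TiT mul1mx.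
exists T, Ti, l; split => //; split.
- move=> i; exists (col i T); last by rewrite mxE.
  apply/eqP => T0; have : col i (Ti *m T) = 0 by rewrite colE -mulmxA -colE T0 mulmx0.
  by rewrite TiT => /colP/(_ i)/eqP; rewrite !mxE eqxx oner_eq0.
- by move=> i; rewrite mxE.
- have Ai : A = T *m diag_mx (map_mx Hq l) *m Ti.
    by rewrite -TAT !mulmxA TTi mul1mx -mulmxA TTi mulmx1.
  rewrite chi_mxE Ai !chiM char_poly_similar ?char_poly_chi_diag //.
  by rewrite -chiM TTi chi1.
Qed.

End Quaternions.

(** * Eigenvectors of the companion matrix *)

Theorem theorem3p11 (R : realType) (n : nat) (U0 U1 : 'M[quat R]_n)
    (hU0 : unitarymxq U0) (hU1 : unitarymxq U1)
    (hcomm : U0 *m U1 = U1 *m U0) :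
  diagonalizablemxq (block_companion U0 U1).
Proof.
have [|P [a [b [Pu U0P U1P a1 b1]]]] :=
    unitarymx_codiag (chi_unitary hU0) (chi_unitary hU1).
  by rewrite -!chiM hcomm.
(* Quaternion diagonal matrices with complex entries commute with each other, so identities among
   them reduce to scalar ones. *)
pose H (d : 'I_(n + n) -> R[i]) :=
  diag_mx (map_mx (@quat_of_complex R) (\row_i d i)).
have HE (d : 'rV[R[i]]_(n + n)) : map_mx (@quat_of_complex R) (diag_mx d) = H (d 0).
  by apply/matrixP => i j; rewrite !mxE; case: (i == j).
have HM d e : H d *m H e = H (fun i => d i * e i).
  rewrite mulmx_diag; congr diag_mx; apply/rowP => i.
  by rewrite !mxE quat_of_complexM.
have HD d e : H d + H e = H (fun i => d i + e i).
  rewrite -raddfD; congr diag_mx; apply/rowP => i.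
  by rewrite !mxE quat_of_complexD.
have HN d : - H d = H (fun i => - d i).
  rewrite -raddfN; congr diag_mx; apply/rowP => i.
  by rewrite !mxE quat_of_complexN.
have Heq d e : d =1 e -> H d = H e.
  by move=> de; congr diag_mx; apply/rowP => i; rewrite !mxE de.
pose V := qmx P.
have U0V : U0 *m V = V *m H (a 0) by rewrite mulmx_qmx U0P qmx_mulmx HE.
have U1V : U1 *m V = V *m H (b 0) by rewrite mulmx_qmx U1P qmx_mulmx HE.
have /fin_all_exists[r /fin_all_exists[s rs]] i :=
  distinct_roots (a1 i) (b1 i).
(* Column [i] is [(v, v t_i)] for the [i]-th common eigenvector [v]. [W r] and [W s] together supply
   [4n] vectors in dimension [2n]. *)
pose W t := col_mx V (V *m H t).
have eigW t : (forall i, t i ^+ 2 + b 0 i * t i + a 0 i = 0) ->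
    block_companion U0 U1 *m W t = W t *m H t.
  move=> tE; rewrite /block_companion mul_block_col mul0mx mul1mx add0r mul_col_mx.
  congr col_mx; rewrite !mulNmx mulmxA U0V U1V -!mulmxA -opprD -mulmxDr -mulmxN.
  congr (_ *m _); rewrite !HM HD HN; apply: Heq => i.
  apply/eqP; rewrite -subr_eq0 -opprD oppr_eq0 -expr2 addrC (addrC (a 0 i)) addrA.
  by rewrite tE.
(* The columns of [W r] and [W s] together span, in left-kernel form. Subtracting the two equations
   leaves [w2 *m V *m H d = 0] with [d = r - s], and [H d] is invertible because the roots are
   distinct. *)
have kerW w : w *m W r = 0 -> w *m W s = 0 -> w = 0.
  rewrite -[w]hsubmxK !mul_row_col; set w1 := lsubmx w; set w2 := rsubmx w.
  move=> wr ws.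
  have w2V : w2 *m V = 0.
    pose d i := r i - s i.
    have dE : w2 *m V *m H d = 0.
      have -> : H d = H r - H s by rewrite HN HD; apply: Heq.
      have Ht t : w1 *m V + w2 *m (V *m H t) = 0 -> w2 *m V *m H t = - (w1 *m V).
        by move/eqP; rewrite addrC addr_eq0 mulmxA => /eqP.
      by rewrite mulmxBr !Ht // subrr.
    have dd : H d *m H (fun i => (d i)^-1) = 1%:M.
      rewrite HM; apply/matrixP => i j; rewrite !mxE.
      by case: (rs i) => rsi _ _; rewrite mulfV // subr_eq0.
    by rewrite -[LHS]mulmx1 -dd mulmxA dE mul0mx.
  have w20 : w2 = 0 by apply: qmx_unit_lker Pu w2V.
  have w10 : w1 = 0.
    by apply: (qmx_unit_lker Pu); move: wr; rewrite w20 mul0mx addr0.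
  by rewrite w10 w20 row_mx0.
have colW t (w : 'rV[quat R]_(n + n)) :
    (forall i, t i ^+ 2 + b 0 i * t i + a 0 i = 0) -> w *m W t != 0 ->
    exists2 y : 'cV[quat R]_(n + n),
      (exists m, 0 <= complex.Im m /\ block_companion U0 U1 *m y =
         y *m (quat_of_complex m)%:M) & w *m y != 0.
  move=> tE wW.
  (* Some column of [W t] is not killed by [w]; [eigencol_upper] then moves its eigenvalue to the
     closed upper half plane. *)
  have /existsP[i wi] : [exists i, w *m col i (W t) != 0].
    apply: contraR wW; rewrite negb_exists => /forallP w0; apply/eqP/rowP => i.
    have := w0 i; rewrite negbK colE mulmxA -colE => /eqP/colP/(_ 0).
    by rewrite !mxE.
  apply: (@eigencol_upper _ _ _ _ _ (t i)) wi.
  rewrite colE mulmxA eigW // -!mulmxA; congr (_ *m _).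
  apply/colP => k; rewrite -colE !mxE big_ord1 !mxE.
  by have [->|ki] := eqVneq k i; rewrite /= ?mul1r ?mul0r.
have [|T [Ti [TTi TiT PT]]] := invertible_with_cols (@quat_inv R)
  (P := fun y : 'cV[quat R]_(n + n) => exists m, 0 <= complex.Im m /\
     block_companion U0 U1 *m y = y *m (quat_of_complex m)%:M).
  move=> w wn0; have [wr|] := eqVneq (w *m W r) 0; last first.
    by apply: colW => i; case: (rs i).
  apply: (colW s) => [i|]; first by case: (rs i).
  by apply: contra wn0 => /eqP ws; apply/eqP/kerW.
exact: diagonalizable_of_eigencols TTi TiT PT.
Qed.
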